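(* Let $G$ be a torsion-free non-elementary word-hyperbolic group with a marked finite generating set $A$, let $H\le G$ be a quasiconvex subgroup, and let $Y=\Gamma(G/H,A)$ be the relative Cayley graph. Then the simple random walk on $Y$ is transient if and only if $[G:H]=\infty$.
   Context: A marked finite generating set of $G$ is a map $\pi:A\to G$ from a finite alphabet $A$ such that $\pi(A)$ generates $G$. The relative Cayley graph $\Gamma(G/H,A)$ has vertex set the right cosets $Hg$ ($g\in G$) and, for each $(Hg,a)\in G/H\times A$, an edge from $Hg$ to $Hg\pi(a)$ labeled $a$; it is a connected $2|A|$-regular graph. A connected graph of bounded degree is recurrent if the simple random walk returns to the base point with probability 1, and transient otherwise. $H$ quasiconvex means there is $C>0$ such that every geodesic in the Cayley graph $\Gamma(G,A)$ with endpoints in $H$ lies in the $C$-neighborhood of $H$. Non-elementary means not virtually cyclic. *)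

(* Defs.v *)
From Stdlib Require Import Reals ClassicalEpsilon.
From mathcomp Require Import all_boot.

Set Implicit Arguments.
Unset Strict Implicit.
Unset Printing Implicit Defensive.

Record AbsGroup := {
  gcarrier :> Type;
  gmul : gcarrier -> gcarrier -> gcarrier;
  gone : gcarrier;
  ginv : gcarrier -> gcarrier;
  gmulA : forall x y z, gmul x (gmul y z) = gmul (gmul x y) z;
  gmul1l : forall x, gmul gone x = x;
  gmul1r : forall x, gmul x gone = x;
  gmulVl : forall x, gmul (ginv x) x = gone;
  gmulVr : forall x, gmul x (ginv x) = gone
}.

Section GroupDefs.
Variable G : AbsGroup.

Fixpoint gpow (g : G) (n : nat) : G :=
  match n with O => gone G | S m => gmul g (gpow g m) end.

Definition gpowz (g : G) (z : Z) : G :=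
  match z with
  | Z0 => gone G
  | Zpos p => gpow g (Pos.to_nat p)
  | Zneg p => ginv (gpow g (Pos.to_nat p))
  end.

Definition subgroup (H : G -> Prop) : Prop :=
  H (gone G) /\ (forall x y, H x -> H y -> H (gmul x y)) /\
  (forall x, H x -> H (ginv x)).

Definition same_rcoset (H : G -> Prop) (x y : G) : Prop := H (gmul x (ginv y)).

Definition finite_index (H : G -> Prop) : Prop :=
  exists l : list G, forall g, exists x, List.In x l /\ same_rcoset H g x.

Definition cyclic_subgroup (c : G) : G -> Prop := fun g => exists z : Z, g = gpowz c z.

Definition torsion_free : Prop :=
  forall (g : G) (n : nat), (0 < n)%N -> gpow g n = gone G -> g = gone G.

Definition virtually_cyclic : Prop := exists c : G, finite_index (cyclic_subgroup c).
Definition non_elementary : Prop := ~ virtually_cyclic.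

Section Marked.
Variables (A : finType) (pi : A -> G).

Definition letter (x : A * bool) : G := if x.2 then pi x.1 else ginv (pi x.1).

Definition eval_word (w : seq (A * bool)) : G :=
  foldr (fun x acc => gmul (letter x) acc) (gone G) w.

Definition generates : Prop := forall g : G, exists w, eval_word w = g.

Definition path_word (g h : G) (w : seq (A * bool)) : Prop := gmul g (eval_word w) = h.

(* graph distance in Gamma(G, A) (0 if g, h are not connected) *)
Definition wdist (g h : G) : nat :=
  match excluded_middle_informative (exists n, exists w, size w = n /\ path_word g h w) with
  | left e =>
      @ex_minn (fun n => if excluded_middle_informative
                             (exists w, size w = n /\ path_word g h w)
                         then true else false)
               (let (n, Hn) := e in
                ex_intro _ n (match excluded_middle_informative
                                      (exists w, size w = n /\ path_word g h w)
                                as b return ((if b then true else false) = true)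
                              with left _ => erefl | right nH => False_ind _ (nH Hn) end))
  | right _ => 0
  end.

Local Open Scope R_scope.

(* Gromov product (x|y)_w in Gamma(G, A) (restricted to the vertices) *)
Definition gromov (w x y : G) : R :=
  (INR (wdist w x) + INR (wdist w y) - INR (wdist x y)) / 2.

Definition hyperbolic_wrt : Prop :=
  exists delta : R, 0 <= delta /\
    forall w x y z : G, gromov w x z >= Rmin (gromov w x y) (gromov w y z) - delta.

Local Close Scope R_scope.

(* geodesic in Gamma(G,A) from g: word w of minimal length among paths
   with the same endpoints; its vertices are g * eval (take k w). *)
Definition geodesic_word (g : G) (w : seq (A * bool)) : Prop :=
  size w = wdist g (gmul g (eval_word w)).

Definition quasiconvex (H : G -> Prop) : Prop :=
  exists C : nat, forall (h1 : G) (w : seq (A * bool)),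
    H h1 -> H (gmul h1 (eval_word w)) -> geodesic_word h1 w ->
    forall k, (k <= size w)%N ->
      exists h, H h /\ (wdist (gmul h1 (eval_word (take k w))) h <= C)%N.

(* Simple random walk on the relative Cayley graph Y = Gamma(G/H, A).  *)
(* Vertices: right cosets H g; for each (H g, a) an edge H g -> H g pi a.*)
(* Y is 2|A|-regular; a step from H g picks one of the 2|A| edge ends   *)
(* uniformly: (a, true) moves to H g pi(a), (a, false) to H g pi(a)^-1. *)
(* A step sequence s of length n thus has probability (2|A|)^-n, and   *)
(* the walk started at the base point H (coset of 1) is at the coset   *)
(* H * eval (take k s) at time k.                                      *)
Variable H : G -> Prop.

Definition walk_pos (s : seq (A * bool)) (k : nat) : G := eval_word (take k s).

Definition first_return_at (n : nat) (s : seq (A * bool)) : Prop :=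
  (0 < n)%N /\ same_rcoset H (walk_pos s n) (gone G) /\
  forall k, (0 < k)%N -> (k < n)%N -> ~ same_rcoset H (walk_pos s k) (gone G).

Definition first_return_b (n : nat) (s : n.-tuple (A * bool)) : bool :=
  if excluded_middle_informative (first_return_at n s) then true else false.

Local Open Scope R_scope.

Definition first_return_prob (n : nat) : R :=
  INR #|[set s : n.-tuple (A * bool) | first_return_b s]| /
  INR (expn (muln 2 #|A|) n).

Definition srw_recurrent : Prop :=
  Un_cv (fun N => sum_f_R0 (fun n => first_return_prob (S n)) N) 1.

Definition srw_transient : Prop := ~ srw_recurrent.

Local Close Scope R_scope.
End Marked.

Definition word_hyperbolic : Prop :=
  exists (B : finType) (p : B -> G), generates p /\ hyperbolic_wrt p.

End GroupDefs.

(* Main.v *)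
(** A copy of the binary tree of bounded multiplicity in [H\G], with edges of bounded
    length, carries a unit flow of finite energy and so makes the walk transient.

    Torsion-freeness and non-elementarity make the spheres of [G] unbounded: an
    infinite cyclic subgroup of infinite index forces quadratic growth.  Three points
    far apart on a large sphere have a center, from which they are seen as long elements
    [q 0], [q 1], [q 2] with pairwise small Gromov products.  For every [x] at least two of
    the three [q i] extend [x] without backtracking, and this defines a binary tree.  Its
    root is a long shortest representative of a coset [H g0].  By the half of the Morse
    lemma asserting that geodesics stay near quasigeodesics, quasiconvexity bounds the
    Gromov product of [g0] with every element of [H]; hence if [h] in [H] maps a node of the
    tree to a node, then [h] has bounded length, which bounds the multiplicity.

    Let [v] be the probability of hitting [H] within [N] steps.  It is subharmonic off
    the base point, so its Dirichlet energy is at most a constant times the probability of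
    not returning, while the flow bounds this energy below uniformly in [N].  When the index
    is finite, the walk returns from any point within a fixed number of steps with
    probability bounded below, so the escape probability decays geometrically. *)

Require Import Defs.
From Stdlib Require Import Reals Lra ClassicalEpsilon.
From HB Require Import structures.
From mathcomp Require Import all_boot all_order all_algebra zify ring lra.
From mathcomp Require Import boolp Rstruct.

Set Implicit Arguments.
Unset Strict Implicit.
Unset Printing Implicit Defensive.

(** * Groups and word metrics *)

(** Classical equality on [G], so that [uniq] and [\in] apply to lists of group elements. *)
HB.instance Definition _ (G : AbsGroup) := gen_eqMixin (gcarrier G).

Local Notation "x ** y" := (gmul x y) (at level 40, left associativity).

Section GroupLaws.
Variable G : AbsGroup.
Implicit Types x y z : G.

Lemma gmulAr x y z : x ** y ** z = x ** (y ** z).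
Proof. by rewrite gmulA. Qed.

Lemma gmulKl x y : ginv x ** (x ** y) = y.
Proof. by rewrite gmulA gmulVl gmul1l. Qed.

Lemma gmulKVl x y : x ** (ginv x ** y) = y.
Proof. by rewrite gmulA gmulVr gmul1l. Qed.

Lemma ginv_uniq x y : x ** y = gone G -> ginv x = y.
Proof. by move=> E; rewrite -(gmulKl x y) E gmul1r. Qed.

Lemma ginvK x : ginv (ginv x) = x.
Proof. exact/ginv_uniq/gmulVl. Qed.

Lemma ginv1 : ginv (gone G) = gone G.
Proof. exact/ginv_uniq/gmul1l. Qed.

Lemma ginvM x y : ginv (x ** y) = ginv y ** ginv x.
Proof. by apply: ginv_uniq; rewrite gmulAr gmulKVl gmulVr. Qed.

Definition gE :=
  (ginvM, ginvK, ginv1, gmulAr, gmulKl, gmulKVl, gmul1l, gmul1r, gmulVl, gmulVr).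

Lemma gmul_injl x y z : x ** y = x ** z -> y = z.
Proof. by move=> E; rewrite -(gmulKl x y) E gmulKl. Qed.

Lemma gmul_injr x y z : y ** x = z ** x -> y = z.
Proof. by move=> E; rewrite -[y]gmul1r -(gmulVr x) gmulA E !gE. Qed.

Lemma gpowD x m n : gpow x (m + n) = gpow x m ** gpow x n.
Proof. by elim: m => [|m IH]; [rewrite gmul1l|rewrite addSn /= IH gmulA]. Qed.

Lemma gpowSr x n : gpow x n.+1 = gpow x n ** x.
Proof. by rewrite -addn1 gpowD /= !gE. Qed.

Lemma cyclic_subgroupP x y :
  cyclic_subgroup x y <-> exists n, y = gpow x n \/ y = ginv (gpow x n).
Proof.
split=> [[z ->]|[n [->|->]]].
- case: z => [|q|q] /=; first by exists 0; left.
  + by exists (Pos.to_nat q); left.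
  + by exists (Pos.to_nat q); right.
- case: n => [|n]; first by exists Z0.
  by exists (Zpos (Pos.of_succ_nat n)); rewrite /= SuccNat2Pos.id_succ.
- case: n => [|n]; first by exists Z0; rewrite /= ginv1.
  by exists (Zneg (Pos.of_succ_nat n)); rewrite /= SuccNat2Pos.id_succ.
Qed.

Lemma gpow_subl x m n : m <= n -> ginv (gpow x m) ** gpow x n = gpow x (n - m).
Proof. by move=> le; rewrite -{1}(subnKC le) gpowD !gE. Qed.

Lemma gpow_subr x m n : m <= n -> gpow x n ** ginv (gpow x m) = gpow x (n - m).
Proof. by move=> le; rewrite -{1}(subnK le) gpowD !gE. Qed.

Lemma cyclic_subgroup_subgroup x : subgroup (cyclic_subgroup x).
Proof.
split; first by exists Z0.
split=> [y z|y] /cyclic_subgroupP [m Hm]; last first.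
  apply/cyclic_subgroupP; exists m.
  by case: Hm => ->; [right|left; rewrite ginvK].
move=> /cyclic_subgroupP [n Hn]; apply/cyclic_subgroupP.
case: Hm Hn => -> [] ->.
- by exists (m + n); left; rewrite gpowD.
- case: (leqP n m) => [le|/ltnW le].
    by exists (m - n); left; rewrite gpow_subr.
  by exists (n - m); right; rewrite -(gpow_subr x le) !gE.
- case: (leqP m n) => [le|/ltnW le].
    by exists (n - m); left; rewrite gpow_subl.
  by exists (m - n); right; rewrite -(gpow_subl x le) !gE.
- by exists (m + n); right; rewrite addnC gpowD ginvM.
Qed.

Lemma gpow_inj x : torsion_free G -> x <> gone G -> injective (gpow x).
Proof.
move=> tf nx m n; wlog le : m n / m <= n.
  by move=> W E; case: (leqP m n) => [|/ltnW] le; [apply: W|apply/esym/W].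
move=> E; apply/eqP; rewrite eqn_leq le leqNgt; apply/negP => lt.
apply: nx; apply: (tf x (n - m)); first by rewrite subn_gt0.
by rewrite -gpow_subl // E gmulVl.
Qed.

End GroupLaws.

Section WordMetric.
Variables (G : AbsGroup) (B : finType) (p : B -> G).
Hypothesis gen : generates p.
Local Notation d := (wdist p).
Local Notation ev := (eval_word p).

Lemma eval_word_cat u v : ev (u ++ v) = ev u ** ev v.
Proof. by elim: u => [|a u IH] /=; [rewrite gmul1l|rewrite IH gmulA]. Qed.

Definition inv_word (w : seq (B * bool)) := rev [seq (x.1, ~~ x.2) | x <- w].

Lemma eval_inv_word w : ev (inv_word w) = ginv (ev w).
Proof.
elim: w => [|[b e] w IH]; first by rewrite /inv_word /= ginv1.
rewrite /inv_word /= rev_cons -cats1 eval_word_cat -/(inv_word w) IH /= !gE.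
by case: e; rewrite /letter /= ?ginvK.
Qed.

(** Since [p] generates, the default value 0 in [wdist] never arises, and [ex_minn] gives a true
    minimum. *)
Lemma wdist_spec g h :
  (exists w, size w = d g h /\ path_word p g h w) /\
  (forall w, path_word p g h w -> d g h <= size w).
Proof.
rewrite /wdist; case: excluded_middle_informative => [e|ne]; last first.
  case: ne; have [w Ew] := gen (ginv g ** h).
  by exists (size w), w; split=> //; rewrite /path_word Ew !gE.
case: ex_minnP => n; case: excluded_middle_informative => // Hn _ min_n.
split=> // w pw; apply: min_n.
by case: excluded_middle_informative => // -[]; exists w.
Qed.

Lemma wdist_le_size g w : d g (g ** ev w) <= size w.
Proof. by have [_] := wdist_spec g (g ** ev w); apply. Qed.

Lemma wdist_word g h : exists2 w, size w = d g h & h = g ** ev w.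
Proof. by have [[w [sw pw]] _] := wdist_spec g h; exists w. Qed.

Lemma wdistxx g : d g g = 0.
Proof. by apply/eqP; rewrite -leqn0; have := wdist_le_size g [::]; rewrite /= gmul1r. Qed.

Lemma wdist_eq0 g h : d g h = 0 -> g = h.
Proof.
by move=> d0; have [w] := wdist_word g h; rewrite d0 => /size0nil -> ->; rewrite /= gmul1r.
Qed.

Lemma wdist_le_sym g h : d g h <= d h g.
Proof.
have [w <- ->] := wdist_word h g.
have := wdist_le_size (h ** ev w) (inv_word w).
by rewrite eval_inv_word !gE size_rev size_map.
Qed.

Lemma wdistC g h : d g h = d h g.
Proof. by apply/eqP; rewrite eqn_leq !wdist_le_sym. Qed.

Lemma wdist_tri x y z : d x z <= d x y + d y z.
Proof.
have [u <- ->] := wdist_word x y; have [v <- ->] := wdist_word (x ** ev u) z.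
by rewrite gmulAr -eval_word_cat -size_cat wdist_le_size.
Qed.

Lemma wdist_mul_le k g h : d (k ** g) (k ** h) <= d g h.
Proof.
by have [w <- ->] := wdist_word g h; rewrite gmulA; exact: wdist_le_size.
Qed.

Lemma wdist_mul k g h : d (k ** g) (k ** h) = d g h.
Proof.
apply/eqP; rewrite eqn_leq wdist_mul_le /=.
by have := wdist_mul_le (ginv k) (k ** g) (k ** h); rewrite !gmulKl.
Qed.

Lemma wdist_mulr x y : d x (x ** y) = d (gone G) y.
Proof. by rewrite -{1}[x]gmul1r wdist_mul. Qed.

Lemma wdist_between x y n : n <= d x y ->
  exists2 z, d x z = n & d z y = d x y - n.
Proof.
have [w sw Ey] := wdist_word x y => le_n.
exists (x ** ev (take n w));
  have := wdist_le_size x (take n w); have := wdist_le_size (x ** ev (take n w)) (drop n w);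
  rewrite gmulAr -eval_word_cat cat_take_drop -Ey size_drop size_takel ?sw //;
  have := wdist_tri x (x ** ev (take n w)) y; lia.
Qed.

Lemma ball_finite n : exists l : seq G, forall g, d (gone G) g <= n -> g \in l.
Proof.
elim: n => [|n [l Hl]].
  by exists [:: gone G] => g; rewrite leqn0 => /eqP/wdist_eq0 <-; rewrite inE.
exists (l ++ [seq x ** letter p a | x <- l, a <- enum {: B * bool}]) => g le_g.
rewrite mem_cat; case: (leqP (d (gone G) g) n) => [/Hl -> //|lt_g].
have [w sw Eg] := wdist_word (gone G) g.
case/lastP: w sw Eg => [|w a]; first by move=> /= sw; lia.
rewrite size_rcons -cats1 eval_word_cat /= !gE => sw ->.
apply/orP; right; apply/allpairsP; exists (ev w, a); split; rewrite ?mem_enum //.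
by apply: Hl => /=; have := wdist_le_size (gone G) w; rewrite gmul1l; lia.
Qed.

End WordMetric.

(** * Growth and diverging elements *)

Lemma ex_minimum (P : nat -> Prop) :
  (exists n, P n) -> exists2 m, P m & forall n, P n -> m <= n.
Proof.
move=> [n0 Pn0]; have exP : exists n, `[< P n >] by exists n0; apply/asboolP.
by case: (ex_minnP exP) => m /asboolP Pm min_m; exists m => // n /asboolP/min_m.
Qed.

(** Gromov's inequality doubled, with the minimum turned into a disjunction, so that it lives in
    [nat] and [lia] applies; [D] bounds [2 * delta]. *)
Definition four_point (G : AbsGroup) (d : G -> G -> nat) (D : nat) : Prop :=
  forall w x y z, d x z + d y w <= d x y + d z w + D \/ d x z + d y w <= d y z + d x w + D.

Section Growth.
Variables (G : AbsGroup) (B : finType) (p : B -> G).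
Hypothesis gen : generates p.
Local Notation d := (wdist p).
Local Notation "1" := (gone G).

Lemma hyperbolic_four_point : hyperbolic_wrt p -> exists D, four_point d D.
Proof.
move=> [delta [delta0 hyp]].
have [D HD] := INR_unbounded (Rplus delta delta).
exists D => w x y z; have := hyp w x y z; rewrite /gromov => /Rge_le.
have C : forall u v, INR (d u v) = INR (d v u) by move=> u v; rewrite wdistC.
rewrite /Rmin; case: Rle_dec => _ H; [left|right];
  apply/ssrnat.leP/INR_le; rewrite !plus_INR;
  have := C w x; have := C w y; have := C w z; Lra.lra.
Qed.

(** Infinite index gives a coset that misses the ball of radius [n]. On a geodesic from [1] to a
    shortest element of it, the point at distance [n] is again shortest in its own coset. *)
Lemma coset_sphere (K : G -> Prop) n : subgroup K -> ~ finite_index K ->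
  exists2 x, d 1 x = n & forall k, K k -> n <= d 1 (k ** x).
Proof.
move=> [K1 [KM KV]] infK; have [l Hl] := ball_finite gen n.
have [y far_y] : exists y, forall k, K k -> n < d 1 (k ** y).
  apply: contrapT => none; apply: infK; exists l => g.
  have /existsNP [k /not_implyP [Kk]] : ~ forall k, K k -> n < d 1 (k ** g).
    by move=> far; apply: none; exists g.
  move/negP; rewrite -leqNgt => /Hl kg_l; exists (k ** g); split; last first.
    by rewrite /same_rcoset !gE; apply: KV.
  elim: l kg_l {Hl} => [|u l IH] //; rewrite inE => /orP [/eqP ->|/IH]; [by left|by right].
have [m [k0 Kk0 Em] min_m] :
    exists2 m, (exists2 k, K k & d 1 (k ** y) = m) &
               forall j, (exists2 k, K k & d 1 (k ** y) = j) -> m <= j.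
  by apply: ex_minimum; exists (d 1 (1 ** y)), 1.
have [z dz dz'] := wdist_between gen (n := n) (x := 1) (y := k0 ** y) (ltnW (far_y _ Kk0)).
exists z => // k Kk.
have := min_m _ (ex_intro2 _ _ (k ** k0) (KM _ _ Kk Kk0) erefl).
have := wdist_tri gen 1 (k ** z) (k ** (k0 ** y)).
rewrite wdist_mul // -gmulA; have := far_y _ Kk0; lia.
Qed.

(** If spheres had at most [M] elements, balls would grow linearly. But for [g <> 1] and [x j] of
    length [j], shortest in its coset of the cyclic group of [g], the elements [gpow g i ** x j]
    with [i, j < N] are [N * N] distinct elements of a ball of radius linear in [N]. *)
Lemma sphere_unbounded : torsion_free G -> non_elementary G ->
  forall M, exists n (s : seq G),
    [/\ uniq s, M < size s & forall x, x \in s -> d 1 x = n].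
Proof.
move=> tf ne M; apply: contrapT => none.
have sphere n (s : seq G) : uniq s -> (forall x, x \in s -> d 1 x = n) -> size s <= M.
  by move=> us Hs; rewrite leqNgt; apply/negP => lt; apply: none; exists n, s.
have ball n : forall s : seq G, uniq s -> (forall x, x \in s -> d 1 x <= n) ->
    size s <= M * n.+1.
  elim: n => [|n IH] s us Hs.
    by rewrite muln1; apply: (sphere 0) => // x /Hs; rewrite leqn0 => /eqP.
  rewrite -(count_predC [pred x | d 1 x <= n] s) -!size_filter.
  rewrite mulnS addnC; apply: leq_add.
    apply: (sphere n.+1); rewrite ?filter_uniq // => x.
    by rewrite mem_filter /= => /andP [+ /Hs]; lia.
  by apply: IH; rewrite ?filter_uniq // => x; rewrite mem_filter => /andP [].
have [g ng] : exists g : G, g <> 1.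
  apply: contrapT => triv; apply: ne; exists 1, [:: 1] => g.
  exists 1; split; first by left.
  exists Z0; apply: contrapT => ng; apply: triv; eexists; exact: ng.
have infg : ~ finite_index (cyclic_subgroup g) by move=> fi; apply: ne; exists g.
have sg := cyclic_subgroup_subgroup g.
have pow_in i : cyclic_subgroup g (gpow g i) by apply/cyclic_subgroupP; exists i; left.
have /boolp.choice [x Hx] : forall n, exists x, d 1 x = n /\
    forall k, cyclic_subgroup g k -> n <= d 1 (k ** x).
  by move=> n; have [x ? ?] := coset_sphere n sg infg; exists x.
have x_coset i j k l : gpow g i ** x j = gpow g k ** x l -> l <= j.
  move=> E; have [<- _] := Hx j; have [_ Hl] := Hx l.
  have -> : x j = ginv (gpow g i) ** gpow g k ** x l by rewrite gmulAr -E !gE.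
  by apply: Hl; apply sg.2.1; [apply sg.2.2|]; apply: pow_in.
have lenpow i : d 1 (gpow g i) <= i * d 1 g.
  elim: i => [|i IH]; first by rewrite wdistxx.
  rewrite gpowSr mulSn; have := wdist_tri gen 1 (gpow g i) (gpow g i ** g).
  by rewrite wdist_mulr //; lia.
(* Chosen so that [N * N] exceeds [M * (N * (d 1 g).+1).+1], the supposed bound for the ball of
   radius [N * (d 1 g).+1]. *)
pose N := M * (d 1 g).+1 + M + 1.
have := ball (N * (d 1 g).+1) [seq gpow g i ** x j | i <- iota 0 N, j <- iota 0 N].
rewrite size_allpairs size_iota leqNgt => H; suff /negP [] : ~~ (M * (N * (d 1 g).+1).+1 < N * N).
  have -> : M * (N * (d 1 g).+1).+1 = N * (M * (d 1 g).+1) + M by lia.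
  have -> : N * N = N * (M * (d 1 g).+1) + N * M + N by rewrite {2}/N !mulnDr muln1.
  by rewrite /N; nia.
apply: H.
- apply: allpairs_uniq; rewrite ?iota_uniq // => -[i j] [k l] _ _ /= E.
  have Ejl : j = l by apply/eqP; rewrite eqn_leq (x_coset _ _ _ _ E) (x_coset _ _ _ _ (esym E)).
  by rewrite Ejl in E *; move/gmul_injr/(gpow_inj tf ng): E => ->.
- move=> y /allpairsP [[i j] /= []]; rewrite !mem_iota /= !add0n => lti ltj ->.
  have := wdist_tri gen 1 (gpow g i) (gpow g i ** x j).
  rewrite wdist_mulr // (Hx j).1; have := lenpow i.
  have : i * d 1 g <= N * d 1 g by rewrite leq_mul2r ltnW ?orbT.
  by rewrite mulnS; lia.
Qed.

(** At most [size l] points of the sphere lie within [r] of a given one; removing those near [x],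
    then those near [y], still leaves a point [z]. *)
Lemma three_separated : torsion_free G -> non_elementary G -> forall r,
  exists n x y z, [/\ d 1 x = n, d 1 y = n & d 1 z = n] /\
                  [/\ r < d x y, r < d x z & r < d y z].
Proof.
move=> tf ne r; have [l Hl] := ball_finite gen r.
have [n [s [us lts Hs]]] := sphere_unbounded tf ne (size l + size l).
have few x : count [pred y | d x y <= r] s <= size l.
  rewrite -size_filter -(size_map (gmul (ginv x))); apply: uniq_leq_size.
    by rewrite map_inj_uniq ?filter_uniq // => y z /gmul_injl.
  move=> y /mapP [z]; rewrite mem_filter /= => /andP [le _] ->.
  by apply: Hl; rewrite -(wdist_mul gen x) !gE.
have [x sx] : exists x, x \in s.
  by case: s lts {us Hs few} => [|x s] //; exists x; rewrite inE eqxx.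
have cut y (t : pred G) : count t s <= count [pred z | (r < d y z) && t z] s + size l.
  rewrite addnC; apply: leq_trans (leq_add (few y) (leqnn _)).
  rewrite -count_predUI; apply: leq_trans (leq_addr _ _).
  by apply: sub_count => z /= tz; rewrite tz andbT; case: leqP.
have pos (t : pred G) : 0 < count t s -> exists2 z, z \in s & t z.
  by rewrite -has_count => /hasP.
have [|y sy /= /andP [rxy _]] := pos [pred z | (r < d x z) && true].
  by have /= := cut x xpredT; rewrite count_predT; lia.
have [|z sz /= /and3P [ryz rxz _]] := pos [pred z | [&& r < d y z, r < d x z & true]].
  have /= := cut x xpredT; have /= := cut y [pred z | (r < d x z) && true].
  by rewrite count_predT; lia.
by exists n, x, y, z; rewrite !Hs.
Qed.

(** On a sphere the distances between points are ultrametric up to [D], so separation makes the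
    Gromov products of [x], [y], [z] based at one another at least [L]. The center [o] is the point
    of a geodesic from [x] to [y] at distance [t], the rounded product of [y] and [z] at [x];
    translating [o] to [1] gives [q]. *)
Lemma three_diverging D : four_point d D -> torsion_free G -> non_elementary G ->
  forall L, exists q : 'I_3 -> G, (forall i, L <= d 1 (q i)) /\
    forall i j, i != j -> d 1 (q i) + d 1 (q j) <= d (q i) (q j) + D + 2.
Proof.
move=> hyp tf ne L.
have [n [x [y [z [[dx dy dz] [xy xz yz]]]]]] := three_separated tf ne (2 * L + D + 2).
have dC := wdistC gen.
pose t := (d x y + d x z - d y z)./2.
have [o ox oy] : exists2 o, d x o = t & d o y = d x y - t.
  by apply: wdist_between => //; have := wdist_tri gen x y z; have := wdist_tri gen x z y;
     rewrite (dC z y) /t; lia.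
have h1 := hyp 1 y x z; have h2 := hyp 1 x y z; have h3 := hyp 1 x z y; have h := hyp o x z y.
have t1 := wdist_tri gen x o z; have t2 := wdist_tri gen y x z; have t3 := wdist_tri gen x y z.
have t4 := wdist_tri gen x z y.
have [c1 [c2 [c3 [c4 [c5 c6]]]]] := (dC x y, (dC x z, (dC y z, (dC x o, (dC y o, dC z o))))).
have [c7 [c8 c9]] := (dC x 1, (dC y 1, dC z 1)).
exists (fun i : 'I_3 => ginv o ** nth 1 [:: x; y; z] i).
have len u : d 1 (ginv o ** u) = d o u by rewrite -(wdist_mul gen o) !gE.
split=> [i|i j]; rewrite !len ?wdist_mul //.
  by case: i => [[|[|[|]]]] //= _; rewrite /t in ox oy; lia.
by case: i j => [[|[|[|]]]] //= _ [[|[|[|]]]] //= _ _; rewrite /t in ox oy; lia.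
Qed.

End Growth.

(** * Quasiconvex subgroups *)

(** Hyperbolicity is known for some generating set [B], quasiconvexity for [A]; this bound passes
    between the two metrics. *)
Lemma wdist_lipschitz (G : AbsGroup) (A B : finType) (pi : A -> G) (p : B -> G) :
  generates pi -> generates p ->
  exists K, forall x y, wdist pi x y <= K * wdist p x y.
Proof.
move=> genA genB; pose K := \max_(a : B * bool) wdist pi (gone G) (letter p a).
exists K => x y; have [w <- ->] := wdist_word genB x y.
elim: w x => [|a w IH] x; first by rewrite /= gmul1r wdistxx.
rewrite /= gmulA mulnS; apply: leq_trans (wdist_tri genA _ (x ** letter p a) _) _.
by apply: leq_add (IH _); rewrite wdist_mulr // (leq_bigmax a).
Qed.

(** [X] bounds from below twice the Gromov product at [o] of consecutive points. Bisecting the chain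
    costs one [D] per halving, hence a loss only logarithmic in its length. *)
Lemma chain_four_point (G : AbsGroup) (d : G -> G -> nat) D (f : nat -> G) o X :
  (forall x y, d x y = d y x) -> four_point d D ->
  forall m a n, 0 < n <= 2 ^ m ->
  (forall i, a <= i < a + n -> X + d (f i) (f i.+1) <= d o (f i) + d o (f i.+1)) ->
  X + d (f a) (f (a + n)) <= d o (f a) + d o (f (a + n)) + D * m.
Proof.
move=> dC hyp; elim=> [|m IH] a n /andP [n0 lt_n] Hf.
  have -> : n = 1 by move: lt_n; rewrite expn0; lia.
  by rewrite addn1 muln0 addn0; apply: Hf; lia.
case: (leqP n (2 ^ m)) => [le|lt].
  by apply: leq_trans (IH a n _ Hf) _; rewrite ?n0 // leq_add2l leq_mul2l leqnSn orbT.
have pos : 0 < 2 ^ m by rewrite expn_gt0.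
rewrite expnS in lt_n.
move: (IH a (2 ^ m)) (IH (a + 2 ^ m) (n - 2 ^ m)) => I2 I1.
move: I1; have -> : a + 2 ^ m + (n - 2 ^ m) = a + n by lia.
have [c1 [c2 c3]] := (dC o (f a), (dC o (f (a + 2 ^ m)), dC o (f (a + n)))).
rewrite mulnS; case: (hyp o (f a) (f (a + 2 ^ m)) (f (a + n))) => H4 I1.
- have {I2} := I2 ltac:(lia) ltac:(by move=> i Hi; apply: Hf; lia); lia.
- have {I1} := I1 ltac:(lia) ltac:(by move=> i Hi; apply: Hf; lia); lia.
Qed.

Lemma leq_mul_self n : n <= n * n.
Proof. by case: n => // n; rewrite leq_pmulr. Qed.

(** A quantity bounded linearly by its own logarithm is bounded. The logarithm is replaced by a
    square root: with [s] least such that [c * e <= s * s], the choice [m = s + s] is allowed. *)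
Lemma exp_linear_bound c K D : exists E, forall e,
  (forall m, c * e <= 2 ^ m -> 2 * e <= K + D * (m + 2)) -> e <= E.
Proof.
exists (K + D * (2 * (c * K + 4 * (c * D) + 3) + 2)) => e He.
have [s Hs min_s] := @ex_minimum (fun s => c * e <= s * s) (ex_intro _ (c * e) (leq_mul_self _)).
have := He (s + s) _; case: (leqP s (c * K + 4 * (c * D) + 3)) => [le_s|lt_s].
  have sq : s * s <= 2 ^ (s + s) by rewrite expnD leq_mul // ltnW // ltn_expl.
  move/(_ (leq_trans Hs sq)) => H.
  have : D * (s + s + 2) <= D * (2 * (c * K + 4 * (c * D) + 3) + 2).
    by rewrite leq_mul2l; apply/orP; right; lia.
  by lia.
have sq : s * s <= 2 ^ (s + s) by rewrite expnD leq_mul // ltnW // ltn_expl.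
move/(_ (leq_trans Hs sq)) => H.
case: s Hs min_s lt_s sq H => [|s] // Hs min_s lt_s sq H.
have ltc : s * s < c * e by rewrite ltnNge; apply/negP => /min_s; rewrite ltnn.
have : c * (2 * e) <= c * (K + D * (s.+1 + s.+1 + 2)) by rewrite leq_mul2l H orbT.
have -> : c * (2 * e) = 2 * (c * e) by lia.
have -> : c * (K + D * (s.+1 + s.+1 + 2)) = c * K + 2 * (c * D * s) + 4 * (c * D) by lia.
move: (c * D) (c * K) lt_s ltc => u v lt_s ltc H2.
have : s * (v + 4 * u + 3) <= s * s by rewrite leq_mul2l; lia.
by nia.
Qed.

Section Morse.
Variables (G : AbsGroup) (B : finType) (p : B -> G).
Hypothesis gen : generates p.
Local Notation d := (wdist p).
Local Notation "1" := (gone G).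
Variable D : nat.
Hypothesis hyp : four_point d D.

(* At a point [x] of a geodesic at maximal distance [e] from the path, the path
   makes a detour of length [O(e)] avoiding the ball of radius [e] around [x]. *)
Lemma geodesic_near_quasigeodesic K : exists E, forall n (q : nat -> G),
  (forall i j, i <= j <= n -> j - i <= K * d (q i) (q j)) ->
  (forall i, i < n -> d (q i) (q i.+1) <= K) ->
  forall x, d (q 0) x + d x (q n) = d (q 0) (q n) ->
  exists2 j, j <= n & d x (q j) <= E.
Proof.
(* The ends [q j] and [q k] of the detour will be within [6 * e] of each other, so their indices
   differ by at most [6 * K * e]. *)
have [E HE] := exp_linear_bound (6 * K) K D.
have dC := wdistC gen; have tri := wdist_tri gen.
exists E => n q qi qs x0 gx0.
(* All geodesics between the ends are considered at once, and [e] is the largest distance from a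
   point of any of them to the path. *)
pose geo x := d (q 0) x + d x (q n) = d (q 0) (q n).
pose P e := `[< exists x, geo x /\ forall j, j <= n -> e <= d x (q j) >].
have exP : exists e, P e by exists 0; apply/asboolP; exists x0.
have ubP e : P e -> e <= d (q 0) (q n).
  by move=> /asboolP [x [gx /(_ 0 isT)]]; rewrite (dC x (q 0)) => h; rewrite -gx; lia.
case: (ex_maxnP exP ubP) => e /asboolP [x [gx far_x]] max_e.
have near y : geo y -> exists2 j, j <= n & d y (q j) <= e.
  move=> gy; apply: contrapT => none.
  have /max_e : P e.+1; last by rewrite ltnn.
  apply/asboolP; exists y; split=> // j jn; rewrite ltnNge; apply/negP => le.
  by apply: none; exists j.
suff le_E : e <= E by have [j jn dj] := near _ gx0; exists j => //; apply: leq_trans dj le_E.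
(* [y] precedes [x] at distance [2 * e], or is the end [q 0] if that is closer; [z] does the same
   after [x]. By maximality of [e] both are within [e] of the path, and [gy], [gz] say that their
   products at [x] with the nearby path points are at least [e]. *)
have [y [j [jn dqy dxy dyj gy]]] : exists y j,
    [/\ j <= n, d (q 0) y + d y x = d (q 0) x, d y x <= 2 * e, d y (q j) <= e &
        2 * e + d y (q j) <= d x y + d x (q j)].
  case: (leqP (d x (q 0)) (2 * e)) => [le|/ltnW lt].
    exists (q 0), 0; rewrite wdistxx // (dC (q 0)); have := far_x 0 isT; split; lia.
  have [y dy1 dy2] := wdist_between gen lt.
  have [|j jn dj] := near y.
    rewrite /geo; move: gx; rewrite /geo (dC (q 0) y).
    have := tri (q 0) y (q n); have := tri y x (q n).
    by rewrite (dC (q 0) y) (dC y x) (dC (q 0) x); lia.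
  exists y, j; have := far_x j jn; rewrite (dC (q 0) y) (dC y x) (dC (q 0) x); split; lia.
have [z [k [kn dqz dxz dzk gz]]] : exists z k,
    [/\ k <= n, d x z + d z (q n) = d x (q n), d x z <= 2 * e, d z (q k) <= e &
        2 * e + d z (q k) <= d x z + d x (q k)].
  case: (leqP (d x (q n)) (2 * e)) => [le|/ltnW lt].
    exists (q n), n; rewrite wdistxx //; have := far_x n (leqnn n); split; lia.
  have [z dz1 dz2] := wdist_between gen lt.
  have [|k kn dk] := near z.
    rewrite /geo; move: gx; rewrite /geo.
    have := tri (q 0) z (q n); have := tri (q 0) x z; lia.
  exists z, k; have := far_x k kn; split; lia.
have dyz : d y x + d x z <= d y z.
  by move: gx; rewrite /geo; have := tri (q 0) y (q n); have := tri y z (q n); lia.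
have djk : d (q j) (q k) <= 6 * e.
  have := tri (q j) y (q k); have := tri y x (q k); have := tri x z (q k).
  by rewrite (dC (q j) y); lia.
apply: HE => m le_m.
(* The [q i] are at distance at least [e] from [x] with steps at most [K], so the chain lemma
   applies with [X = 2 * e - K]; if this truncates to 0, its hypothesis is the triangle
   inequality. *)
have mid : 2 * e + d (q j) (q k) <= d x (q j) + d x (q k) + D * m + K.
  have fj := far_x j jn; have fk := far_x k kn.
  case: (ltngtP j k) => [lt|lt|eq_jk]; last first.
  - by rewrite -eq_jk wdistxx //; rewrite -eq_jk in fk; lia.
  - have := @chain_four_point _ d D q x (2 * e - K) dC hyp m k (j - k).
    rewrite subnKC ?(ltnW lt) // (dC (q k)) => H; have {}H := H _ _.
    have : 2 * e - K + d (q j) (q k) <= d x (q k) + d x (q j) + D * m; last by lia.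
    apply: H.
      rewrite subn_gt0 lt /=; have := qi k j; rewrite (dC (q k)) => H; have {}H := H ltac:(lia).
      by apply: leq_trans H (leq_trans _ le_m); rewrite mulnAC mulnC leq_mul2r djk orbT.
    move=> i Hi; have := far_x i ltac:(lia); have := far_x i.+1 ltac:(lia).
    have := tri (q i) x (q i.+1); rewrite (dC (q i) x); have := qs i ltac:(lia); lia.
  - have := @chain_four_point _ d D q x (2 * e - K) dC hyp m j (k - j).
    rewrite subnKC ?(ltnW lt) // => H; have {}H := H _ _.
    have : 2 * e - K + d (q j) (q k) <= d x (q j) + d x (q k) + D * m; last by lia.
    apply: H.
      rewrite subn_gt0 lt /=; have H := qi j k ltac:(lia).
      by apply: leq_trans H (leq_trans _ le_m); rewrite mulnAC mulnC leq_mul2r djk orbT.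
    move=> i Hi; have := far_x i ltac:(lia); have := far_x i.+1 ltac:(lia).
    have := tri (q i) x (q i.+1); rewrite (dC (q i) x); have := qs i ltac:(lia); lia.
have [c1 [c2 [c3 [c4 c5]]]] := (dC x y, (dC x z, (dC x (q j), (dC x (q k), dC z (q k))))).
rewrite mulnDr.
(* The product of [y] and [z] at [x] vanishes, while the chain [y], [q j], [q k], [z] bounds it
   below; the two extra links account for [m + 2]. *)
by have [h1|h1] := hyp x y (q j) (q k); have [h2|h2] := hyp x y (q k) z; lia.
Qed.

Variables (A : finType) (pi : A -> G).
Hypothesis genA : generates pi.

(** Up to the product [t] of [g] and [h], geodesics from [1] to [g] and to [h] stay [2 * D]-close.
    The second is near an [A]-geodesic, a quasigeodesic for [d], hence near [H]. So the point [u] at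
    distance [t] towards [g] is near [H], and as [g] is shortest in its coset, [t] is at most the
    distance from [u] to [H]. *)
Lemma quasiconvex_gromov_bound (H : G -> Prop) : H 1 -> quasiconvex pi H ->
  exists k, forall g, (forall h, H h -> d 1 g <= d h g) ->
    forall h, H h -> d 1 g + d 1 h <= d g h + k.
Proof.
move=> H1 [C HC].
have [K1 HK1] := wdist_lipschitz genA gen; have [K2 HK2] := wdist_lipschitz gen genA.
have [E HE] := geodesic_near_quasigeodesic (K1 + K2).
have dC := wdistC gen; have tri := wdist_tri gen.
exists (2 * (2 * D + E + K2 * C) + 1) => g min_g h Hh.
pose t := (d 1 g + d 1 h - d g h)./2.
have t1 := tri 1 g h; have t2 := tri 1 h g; have t3 := dC g h; have t4 := tri g 1 h; have t5 := dC g 1.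
have [u du1 du2] := @wdist_between _ _ p gen 1 g t ltac:(rewrite /t; lia).
have [v dv1 dv2] := @wdist_between _ _ p gen 1 h t ltac:(rewrite /t; lia).
have duv : d u v <= 2 * D.
  have h1 := hyp 1 u g h; have h2 := hyp 1 u h v.
  have [c1 [c2 [c3 [c4 c5]]]] := (dC u 1, (dC v 1, (dC h 1, (dC h v, t5)))).
  by rewrite /t in du1 du2 dv1 dv2; lia.
have [w sw Eh] := wdist_word genA 1 h.
pose q i := eval_word pi (take i w).
have qstep i j : i <= j <= size w -> wdist pi (q i) (q j) <= j - i.
  move=> /andP [ij jn]; rewrite /q -(cat_take_drop i (take j w)) take_takel // eval_word_cat.
  by have := wdist_le_size genA (eval_word pi (take i w)) (drop i (take j w));
     rewrite size_drop size_takel.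
have q0 : q 0 = 1 by rewrite /q take0.
have qn : q (size w) = h by rewrite /q take_size Eh gmul1l.
have [||| j jn vj] := HE (size w) q _ _ v; rewrite ?q0 ?qn.
- move=> i j ij; apply: leq_trans (_ : K1 * d (q i) (q j) <= _); last by rewrite leq_mul2r leq_addr orbT.
  apply: leq_trans (HK1 _ _).
  have := qstep 0 i ltac:(lia); have := qstep j (size w) ltac:(lia).
  have := wdist_tri genA 1 (q i) h; have := wdist_tri genA (q i) (q j) h.
  by rewrite q0 qn; lia.
- move=> i lt_i; apply: leq_trans (HK2 _ _) _; have := qstep i i.+1 ltac:(lia).
  by case: (wdist pi _ _) => [|[|]]; lia.
- by rewrite /t in dv1 dv2; lia.
have [h' [Hh' dh']] : exists h', H h' /\ wdist pi (q j) h' <= C.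
  have [||h' [Hh' dh']] := HC 1 w H1 _ _ j jn; first by rewrite -Eh.
    by rewrite /geodesic_word -Eh.
  by exists h'; rewrite gmul1l in dh'.
have bnd : d (q j) h' <= K2 * C by apply: leq_trans (HK2 _ _) _; rewrite leq_mul2l dh' orbT.
have := min_g h' Hh'; have := tri h' u g; have := tri u v h'; have := tri v (q j) h'.
by rewrite (dC h' u) /t in du1 du2 *; lia.
Qed.

End Morse.

(** * A tree in the coset space *)

Section Tree.
Variables (G : AbsGroup) (B : finType) (p : B -> G).
Hypothesis gen : generates p.
Local Notation d := (wdist p).
Local Notation "1" := (gone G).
Variable D : nat.
Hypothesis hyp : four_point d D.
Variable q : 'I_3 -> G.
Hypothesis q_long : forall i, 10 * D + 10 <= d 1 (q i).
Hypothesis q_div : forall i j, i != j -> d 1 (q i) + d 1 (q j) <= d (q i) (q j) + D + 2.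

(** Twice the Gromov product of [1] and [x ** q i] at [x] is at most [2 * D + 2]. *)
Definition no_backtrack x i := d 1 x + d 1 (q i) <= d 1 (x ** q i) + (2 * D + 2).

(** Seen from [x], the direction of [1] cannot follow both [x ** q i] and [x ** q j], since these
    two diverge. *)
Lemma no_backtrack_or x i j : i != j -> no_backtrack x i \/ no_backtrack x j.
Proof.
move=> /q_div; have dC := wdistC gen; rewrite /no_backtrack.
have := hyp x (x ** q i) 1 (x ** q j).
rewrite !(dC _ x) !wdist_mulr // !wdist_mul // (dC x 1) (dC (x ** q i) 1).
by case=> H1 H2; [left|right]; lia.
Qed.

Lemma two_no_backtrack x :
  exists s : bool -> 'I_3, s true != s false /\ forall b, no_backtrack x (s b).
Proof.
have i01 : ord0 != lift ord0 ord0 :> 'I_3 by [].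
have i02 : ord0 != ord_max :> 'I_3 by [].
have i12 : lift ord0 ord0 != ord_max :> 'I_3 by [].
have [h1|h1] := no_backtrack_or x i01; have [h2|h2] := no_backtrack_or x i12.
- by exists (fun b => if b then ord0 else lift ord0 ord0); split=> // -[].
- by exists (fun b => if b then ord0 else ord_max); split=> // -[].
- have [h3|h3] := no_backtrack_or x i02.
    by exists (fun b => if b then ord0 else lift ord0 ord0); split=> // -[].
  by exists (fun b => if b then lift ord0 ord0 else ord_max); split=> // -[].
- by exists (fun b => if b then lift ord0 ord0 else ord_max); split=> // -[].
Qed.

Variable s : G -> bool -> 'I_3.
Hypothesis s_neq : forall x, s x true != s x false.
Hypothesis s_good : forall x b, no_backtrack x (s x b).
Variable g0 : G.

(* Words grow at the head: [b :: w] is a child of [w]. *)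
Fixpoint tree_node (w : seq bool) : G :=
  if w is b :: w' then tree_node w' ** q (s (tree_node w') b) else g0.

Lemma tree_step b w : let x := tree_node w in let x' := tree_node (b :: w) in
  d 1 x + d x x' <= d 1 x' + (2 * D + 2) /\ 10 * D + 10 <= d x x'.
Proof. by rewrite /= wdist_mulr //; split; [apply: s_good|]. Qed.

(** Small backtracking with long steps is a local condition with a global effect. The step to the
    child [x1] is so long that the product of [x1] and [y] at [x0] is large, so [y] inherits at [x0]
    the small product of [1] and [x1], with a loss of [D] that does not accumulate. *)
Lemma tree_away u w :
  d 1 (tree_node w) + d (tree_node w) (tree_node (u ++ w)) <=
  d 1 (tree_node (u ++ w)) + (3 * D + 2).
Proof.
have dC := wdistC gen.
elim/last_ind: u w => [|u b IH] w; first by rewrite /= wdistxx //; lia.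
rewrite cat_rcons; have := IH (b :: w); have [] := tree_step b w.
set x0 := tree_node w; set x1 := tree_node (b :: w); set y := tree_node _.
have h1 := hyp x1 1 x0 y; have h2 := hyp x0 1 y x1.
have [c1 [c2 [c3 [c4 [c5 c6]]]]] := (dC y x1, (dC y x0, (dC y 1, (dC x0 1, (dC x1 1, dC x1 x0))))).
by lia.
Qed.

Lemma tree_forward u b w :
  d (tree_node (b :: w)) (tree_node (u ++ b :: w)) + d (tree_node w) (tree_node (b :: w)) <=
  d (tree_node w) (tree_node (u ++ b :: w)) + (4 * D + 2).
Proof.
have dC := wdistC gen; have := tree_away u (b :: w); have [] := tree_step b w.
set x0 := tree_node w; set x1 := tree_node (b :: w); set y := tree_node _.
have h1 := hyp x1 1 x0 y.
have [c1 [c2 [c3 [c4 [c5 c6]]]]] := (dC y x1, (dC y x0, (dC y 1, (dC x0 1, (dC x1 1, dC x1 x0))))).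
by lia.
Qed.

Lemma tree_node_neq u b w : tree_node w <> tree_node (u ++ b :: w).
Proof.
move=> E; have := tree_forward u b w; have [_] := tree_step b w.
by rewrite -E wdistxx //; lia.
Qed.

(** A common descendant would have a large product at [x0] with both children, forcing their mutual
    product to be large against [q_div]. *)
Lemma tree_branch_neq u u' b w : tree_node (u ++ b :: w) <> tree_node (u' ++ ~~ b :: w).
Proof.
move=> E; have := tree_forward u b w; have := tree_forward u' (~~ b) w; rewrite -E.
have [_] := tree_step b w; have [_] := tree_step (~~ b) w.
have := q_div (i := s (tree_node w) b) (j := s (tree_node w) (~~ b)).
have -> : s (tree_node w) b != s (tree_node w) (~~ b) by case: b {E}; rewrite // eq_sym.
move/(_ isT); rewrite -(wdist_mulr gen (tree_node w) (q (s _ b))).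
rewrite -(wdist_mulr gen (tree_node w) (q (s _ (~~ b)))) -(wdist_mul gen (tree_node w) (q _)).
rewrite -/(tree_node (b :: w)) -/(tree_node (~~ b :: w)).
set x0 := tree_node w; set x1 := tree_node (b :: w); set x2 := tree_node (~~ b :: w).
set y := tree_node _; have dC := wdistC gen; have := hyp x0 x1 y x2.
rewrite (dC y x0) (dC x2 x0) (dC x1 x0) (dC y x2).
by lia.
Qed.

Lemma tree_node_inj : injective tree_node.
Proof.
suff H u u' z : tree_node (u ++ z) = tree_node (u' ++ z) -> u = u'.
  by move=> w w' E; apply: (H w w' [::]); rewrite !cats0.
elim/last_ind: u u' z => [|u b IH] u' z; case/lastP: u' => [|u' b'] //; rewrite ?cat_rcons.
- by move/tree_node_neq.
- by move/esym/tree_node_neq.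
- case: (eqVneq b b') => [<- /IH -> //|nbb'].
  have -> : b' = ~~ b by case: b b' nbb' => -[].
  by move/tree_branch_neq.
Qed.

Variables (H : G -> Prop) (k : nat).
Hypothesis sgH : subgroup H.
Hypothesis g0_H : forall h, H h -> d 1 g0 + d 1 h <= d g0 h + k.
Hypothesis g0_long : k + 4 * D + 4 <= d 1 g0.

(** Geodesics from [1] to a node pass near the root [g0], which is long; so an element with small
    product with [g0] has small product with the node. *)
Lemma tree_gromov_bound w h : H h -> d 1 (tree_node w) + d 1 h <= d (tree_node w) h + k + D.
Proof.
move=> /g0_H; have := tree_away w [::]; rewrite cats0 /=; set y := tree_node w.
have := hyp 1 g0 y h; have dC := wdistC gen.
by rewrite (dC y 1) (dC h 1) (dC g0 1); lia.
Qed.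

(** If [h] maps the node [y0] to the node [y], then [d 1 h] is the sum of the products at [1] of [y]
    with [h] and of [y0] with [ginv h], so [d 1 h <= k + D]. Nodes in one coset thus inject into a
    ball. *)
Lemma tree_multiplicity : exists M, forall x (l : seq (seq bool)), uniq l ->
  (forall w, w \in l -> H (tree_node w ** ginv x)) -> size l <= M.
Proof.
have [H1 [HM HV]] := sgH; have [b Hb] := ball_finite gen (k + D).
exists (size b) => x [|w0 l] // ul Hl.
rewrite -(size_map (fun w => tree_node w ** ginv (tree_node w0))); apply: uniq_leq_size.
  by rewrite map_inj_uniq // => w w' /gmul_injr/tree_node_inj.
move=> h /mapP [w lw Eh]; apply: Hb.
have Hh : H h.
  have -> : h = tree_node w ** ginv x ** ginv (tree_node w0 ** ginv x) by rewrite Eh !gE.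
  by apply: HM; [apply: Hl|apply/HV/Hl; rewrite inE eqxx].
have Ew : tree_node w = h ** tree_node w0 by rewrite Eh !gE.
have := tree_gromov_bound w Hh; have := tree_gromov_bound w0 (HV _ Hh).
rewrite -(wdist_mulr gen h (tree_node w0)) -Ew.
have -> : d 1 (ginv h) = d 1 h by rewrite wdistC // -(wdist_mul gen h) !gE.
rewrite -(wdist_mul gen h (tree_node w0)) -Ew gmulVr (wdistC gen (tree_node w) 1).
by rewrite (wdistC gen h); lia.
Qed.

End Tree.

Theorem coset_tree (G : AbsGroup) (A : finType) (pi : A -> G) (H : G -> Prop) :
  torsion_free G -> non_elementary G -> word_hyperbolic G -> generates pi ->
  subgroup H -> quasiconvex pi H -> ~ finite_index H ->
  exists (q : 'I_3 -> G) (s : G -> bool -> 'I_3) (g0 : G) (M : nat),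
    forall x (l : seq (seq bool)), uniq l ->
      (forall w, w \in l -> H (tree_node q s g0 w ** ginv x)) -> size l <= M.
Proof.
move=> tf ne [B [p [gen hypB]]] genA sgH qcH infH.
have [D hyp] := hyperbolic_four_point gen hypB.
have [q [q_long q_div]] := three_diverging gen hyp tf ne (10 * D + 10).
have /boolp.choice [s Hs] := two_no_backtrack gen hyp q_div.
have [k Hk] := quasiconvex_gromov_bound gen hyp genA sgH.1 qcH.
have [g0 len_g0 min_g0] := coset_sphere gen (k + 4 * D + 4) sgH infH.
exists q, s, g0; apply: (@tree_multiplicity _ _ _ gen _ hyp _ q_long q_div s _ _ g0 H k) => //.
- by move=> x; case: (Hs x).
- by move=> x; case: (Hs x).
- by apply: Hk => h /sgH.2.2 /min_g0; rewrite -(wdist_mul gen h) !gE len_g0.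
- by rewrite len_g0.
Qed.

(** * Energy *)

Import Order.TTheory GRing.Theory Num.Theory.
Local Open Scope ring_scope.

Fixpoint tree_level n : seq (seq bool) :=
  if n is m.+1 then
    [seq true :: w | w <- tree_level m] ++ [seq false :: w | w <- tree_level m]
  else [:: [::]].

Fixpoint tree_ball n : seq (seq bool) :=
  if n is m.+1 then tree_ball m ++ tree_level m else [::].

Lemma mem_tree_level n w : (w \in tree_level n) = (size w == n).
Proof.
elim: n w => [|n IH] [|b w] //=.
  by rewrite mem_cat; apply/negP => /orP [] /mapP [].
have mem_map_cons (c : bool) :
    (b :: w \in [seq c :: x | x <- tree_level n]) = (b == c) && (size w == n).
  rewrite -IH; apply/mapP/andP => [[x xn [-> ->]]|[/eqP -> wn]] //.
  by exists w.
by rewrite mem_cat !mem_map_cons eqSS; case: b {mem_map_cons}; rewrite ?orbF.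
Qed.

Lemma tree_level_uniq n : uniq (tree_level n).
Proof.
elim: n => [|n IH] //=; rewrite cat_uniq !map_inj_uniq ?IH ?andbT /=; try by move=> ? ? [].
by apply/hasPn => _ /mapP [w _ ->]; apply/negP => /mapP [].
Qed.

Lemma size_tree_level n : size (tree_level n) = (2 ^ n)%N.
Proof. by elim: n => [|n IH] //=; rewrite size_cat !size_map IH expnS mul2n addnn. Qed.

Lemma tree_ball_uniq n : uniq (tree_ball n).
Proof.
suff: uniq (tree_ball n) /\ forall w, w \in tree_ball n -> (size w < n)%N by case.
elim: n => [|n [un Hn]] //=; split.
  rewrite cat_uniq un tree_level_uniq andbT; apply/hasPn => w.
  by rewrite mem_tree_level => /eqP sw; apply/negP => /Hn; rewrite sw ltnn.
by move=> w; rewrite mem_cat mem_tree_level => /orP [/Hn|/eqP ->] //; apply: leqW.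
Qed.

Section Energy.
Variables (R : archiRealFieldType) (G : AbsGroup) (A : finType) (pi : A -> G).
Variable H : G -> Prop.
Hypothesis sgH : subgroup H.
Local Notation "1g" := (gone G).
Local Notation step x a := (x ** letter pi a).
Local Notation coset := (same_rcoset H).

(** The left side pairs the gradient of [f] with the unit flow that halves at each branching. On an
    edge with flow [t], the pairing is at most the squared difference plus [t ^+ 2 / 4], and the
    flow has energy [1 - 2 ^- n] down to level [n]. *)
Lemma tree_flow (f : seq bool -> R) n :
  f [::] - (\sum_(w <- tree_level n) f w) / 2 ^+ n <=
  \sum_(w <- tree_ball n) \sum_(b : bool) (f w - f (b :: w)) ^+ 2 + (1 - 2 ^- n) / 4.
Proof.
elim: n => [|n IH]; first by rewrite /= big_seq1 big_nil expr0; lra.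
pose t : R := 2 ^- n.+1; have t0 : 0 < t by rewrite invr_gt0 exprn_gt0.
have tE : 2 ^- n = 2 * t :> R.
  by rewrite /t exprS invfM mulrA mulfV ?mul1r // pnatr_eq0.
rewrite /= big_cat /= !big_cat !big_map /= -/t; move: IH; rewrite tE.
set S := \sum_(w <- tree_ball n) _; set b := \sum_(w <- tree_level n) f w => IH.
have amgm w : t * (f w - f (true :: w)) + t * (f w - f (false :: w)) <=
    \sum_(b : bool) (f w - f (b :: w)) ^+ 2 + t ^+ 2 / 2.
  rewrite big_bool /=; set x := f w - _; set y := f w - _.
  have := sqr_ge0 (x - t / 2); have := sqr_ge0 (y - t / 2); rewrite !expr2; lra.
have : \sum_(w <- tree_level n) (t * (f w - f (true :: w)) + t * (f w - f (false :: w))) <=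
    \sum_(w <- tree_level n) (\sum_(b : bool) (f w - f (b :: w)) ^+ 2 + t ^+ 2 / 2).
  by apply: ler_sum => w _.
rewrite !big_split /= -!mulr_sumr !sumrB -/b big_const_seq count_predT size_tree_level.
rewrite iter_addr_0 -[2^-1 *+ _]mulr_natr natrX.
have -> : t ^+ 2 * (2^-1 * 2 ^+ n) = t / 4.
  have -> : 2 ^+ n = (2 * t)^-1 :> R by rewrite -tE invrK.
  by field; rewrite gt_eqF.
lra.
Qed.

(** Sums over vertices of the coset graph are written as sums over such a list [O] of
    representatives. *)
Lemma inequivalent_cover (l : seq G) : exists O : seq G, [/\ uniq O,
  forall x y, x \in O -> y \in O -> coset x y -> x = y &
  forall x, x \in l -> exists2 y, y \in O & coset x y].
Proof.
have [H1 [HM HV]] := sgH.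
elim: l => [|x l [O [uO iO cO]]]; first by exists [::].
case: (pselect (exists2 y, y \in O & coset x y)) => [xO|nxO].
  by exists O; split=> // y; rewrite inE => /orP [/eqP ->|/cO].
exists (x :: O); split.
- rewrite /= uO andbT; apply/negP => xO; apply: nxO; exists x => //.
  by rewrite /same_rcoset gmulVr.
- move=> y z; rewrite !inE => /orP [/eqP ->|yO] /orP [/eqP ->|zO] // yz.
  + by case: nxO; exists z.
  + by case: nxO; exists y => //; move/HV: yz; rewrite /same_rcoset !gE.
  + exact: iO.
- move=> y; rewrite inE => /orP [/eqP ->|/cO [z zO yz]].
    by exists x; rewrite ?inE ?eqxx // /same_rcoset gmulVr.
  by exists z; rewrite ?inE ?zO ?orbT.
Qed.

Definition coset_invariant (f : G -> R) := forall h x, H h -> f (h ** x) = f x.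

Lemma coset_invariantE f x y : coset_invariant f -> coset x y -> f x = f y.
Proof. by move=> fH xy; rewrite -(fH _ y xy) !gE. Qed.

Definition multiplicity_le (T : Type) (phi : T -> G) (l : seq T) (M : nat) :=
  forall x, (count (fun t => `[< coset (phi t) x >]) l <= M)%N.

Lemma multiplicity_mulr (T : Type) (phi : T -> G) l M g :
  multiplicity_le phi l M -> multiplicity_le (fun t => phi t ** g) l M.
Proof.
move=> mul x; apply: leq_trans (mul (x ** ginv g)); apply/eq_leq/eq_count => t.
by rewrite /same_rcoset !gE.
Qed.

Lemma sum_multiplicity_le (T : Type) (phi : T -> G) (l : seq T) M O f :
  coset_invariant f -> (forall x, 0 <= f x) ->
  (forall x, f x != 0 -> exists2 y, y \in O & coset x y) ->
  multiplicity_le phi l M ->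
  \sum_(t <- l) f (phi t) <= M%:R * \sum_(x <- O) f x.
Proof.
move=> fH f0 fO mul.
apply: (@le_trans _ _ (\sum_(t <- l) \sum_(x <- O) (`[< coset (phi t) x >]%:R * f x))).
  apply: ler_sum => t _; case: (eqVneq (f (phi t)) 0) => [->|/fO [y yO ty]].
    by apply: sumr_ge0 => x _; rewrite mulr_ge0.
  rewrite (big_rem y) //= (asboolT ty) mul1r -(coset_invariantE fH ty) lerDl.
  by apply: sumr_ge0 => x _; rewrite mulr_ge0.
rewrite exchange_big /= mulr_sumr; apply: ler_sum => x _.
rewrite -mulr_suml ler_wpM2r //.
rewrite -natr_sum ler_nat; apply: leq_trans (mul x).
rewrite -sum1_count [X in (_ <= X)%N]big_mkcond; apply: eq_leq; apply: eq_bigr => t _.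
by case: `[< _ >].
Qed.

Definition local_energy (v : G -> R) x := \sum_(a : A * bool) (v x - v (step x a)) ^+ 2.

Lemma local_energy_ge0 v x : 0 <= local_energy v x.
Proof. by apply: sumr_ge0 => a _; apply: sqr_ge0. Qed.

Lemma local_energy_invariant v : coset_invariant v -> coset_invariant (local_energy v).
Proof. by move=> vH h x Hh; apply: eq_bigr => a _; rewrite gmulAr !(vH h). Qed.

(** The recursion comes from [(x + y) ^+ 2 <= 2 * x ^+ 2 + 2 * y ^+ 2], applied at each letter. *)
Fixpoint path_cost (u : seq (A * bool)) : R :=
  if u is _ :: u' then 2 + 2 * path_cost u' else 0.

Lemma path_cost_ge0 u : 0 <= path_cost u.
Proof. by elim: u => //= a u IH; lra. Qed.

Section Dirichlet.
Variables (v : G -> R) (O : seq G).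
Hypothesis vH : coset_invariant v.
Hypothesis v0 : forall x, 0 <= v x.
Hypothesis vO : forall x, v x != 0 -> exists2 y, y \in O & coset x y.
Hypothesis vO' : forall x a, v (step x a) != 0 -> exists2 y, y \in O & coset x y.

(** If [O] represents once each coset in the support of [v] and each neighbor of it, this is twice
    the Dirichlet energy, every edge being seen from both ends. *)
Definition energy := \sum_(x <- O) local_energy v x.

Lemma energy_ge0 : 0 <= energy.
Proof. by apply: sumr_ge0 => x _; apply: local_energy_ge0. Qed.

Lemma local_energy_supp x : local_energy v x != 0 -> exists2 y, y \in O & coset x y.
Proof.
move=> e0; apply: contrapT => none; case/negP: e0; apply/eqP.
have vx : v x = 0 by apply: contrapT => /eqP/vO/none.
rewrite /local_energy big1 // => a _.
have -> : v (step x a) = 0 by apply: contrapT => /eqP/vO'/none.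
by rewrite vx subrr expr0n.
Qed.

(** Right translation preserves multiplicity, so each letter of [u] costs at most [M] times the
    energy. *)
Lemma sum_path_energy u (T : Type) (phi : T -> G) (l : seq T) M :
  multiplicity_le phi l M ->
  \sum_(t <- l) (v (phi t) - v (phi t ** eval_word pi u)) ^+ 2 <=
  path_cost u * (M%:R * energy).
Proof.
elim: u phi => [|a u IH] phi mul.
  by rewrite mul0r big1 // => t _; rewrite /= gmul1r subrr expr0n.
have {}IH := IH _ (multiplicity_mulr (letter pi a) mul).
have e1 : \sum_(t <- l) (v (phi t) - v (step (phi t) a)) ^+ 2 <= M%:R * energy.
  apply: le_trans (sum_multiplicity_le (local_energy_invariant vH) (local_energy_ge0 v)
                     local_energy_supp mul).
  apply: ler_sum => t _; rewrite /local_energy (bigD1 a) //= lerDl.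
  by apply: sumr_ge0 => b _; apply: sqr_ge0.
apply: (@le_trans _ _ (\sum_(t <- l) (2 * (v (phi t) - v (step (phi t) a)) ^+ 2 +
   2 * (v (step (phi t) a) - v (step (phi t) a ** eval_word pi u)) ^+ 2))).
  apply: ler_sum => t _; rewrite /= gmulA; set x := v _; set y := v _; set z := v _.
  have := sqr_ge0 (x - 2 * z + y); rewrite !expr2; nra.
rewrite big_split /= -!mulr_sumr; lra.
Qed.

Hypothesis uO : uniq O.
Hypothesis iO : forall x y, x \in O -> y \in O -> coset x y -> x = y.

(** Green's formula: with [y = step x a], [(v x - v y) ^+ 2 = 2 * v x * (v x - v y) + (v y ^+ 2 - v
    x ^+ 2)], and the last terms sum to at most 0 because right multiplication is injective on
    cosets. *)
Lemma energy_le :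
  energy <= 2 * \sum_(x <- O) v x * \sum_(a : A * bool) (v x - v (step x a)).
Proof.
have shift a : \sum_(x <- O) v (step x a) ^+ 2 <= \sum_(x <- O) v x ^+ 2.
  rewrite -[X in _ <= X]mul1r.
  apply: (@sum_multiplicity_le _ (fun x => step x a) O 1 O (fun x => v x ^+ 2)).
  - by move=> h x Hh; rewrite vH.
  - by move=> x; apply: sqr_ge0.
  - by move=> x; rewrite sqrf_eq0; apply: vO.
  - apply: multiplicity_mulr => x; rewrite -size_filter.
    case E: (filter _ O) => [|y [|z s]] //.
    have := filter_uniq (fun t => `[< coset t x >]) uO; rewrite E /= inE => /andP [].
    have : y \in [seq t <- O | `[< coset t x >]] by rewrite E !inE eqxx.
    have : z \in [seq t <- O | `[< coset t x >]] by rewrite E !inE eqxx orbT.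
    rewrite !mem_filter => /andP [/asboolP zx zO] /andP [/asboolP yx yO].
    rewrite (iO yO zO) ?eqxx //; have [_ [HM HV]] := sgH.
    have -> : coset y z = H (y ** ginv x ** ginv (z ** ginv x)) by rewrite /same_rcoset !gE.
    by apply: HM => //; apply: HV.
rewrite /energy /local_energy.
under [X in _ <= 2 * X]eq_bigr do rewrite mulr_sumr.
rewrite exchange_big [X in _ <= 2 * X]exchange_big /= mulr_sumr.
apply: ler_sum => a _; rewrite mulr_sumr.
rewrite -subr_ge0 -sumrB; move: (shift a); rewrite -subr_ge0 -sumrB => /le_trans; apply.
by apply: ler_sum => x _; rewrite !expr2; nra.
Qed.

(* Subharmonicity fails only at the base point, so the energy is controlled by
   the escape rate there. *)
Lemma energy_le_escape : (forall x, H x -> v x = 1) ->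
  (forall x, ~ H x -> \sum_(a : A * bool) (v x - v (step x a)) <= 0) ->
  energy <= 2 * \sum_(a : A * bool) (1 - v (letter pi a)).
Proof.
move=> v1 vsub; apply: le_trans energy_le _; rewrite ler_wpM2l //.
have [H1 [HM HV]] := sgH.
have [o oO Ho] : exists2 y, y \in O & coset 1g y.
  by apply: vO; rewrite v1 // oner_neq0.
have {}Ho : H o by move/HV: Ho; rewrite /same_rcoset !gE.
rewrite (bigD1_seq o) //= v1 // mul1r -[X in _ <= X]addr0; apply: lerD.
  by apply: ler_sum => a _; rewrite vH.
rewrite big_seq_cond; apply: sumr_le0 => x /andP [xO xo].
rewrite mulr_ge0_le0 // vsub // => Hx; case/eqP: xo; apply: iO => //.
by apply: HM => //; apply: HV.
Qed.

End Dirichlet.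

Variables (q : 'I_3 -> G) (s : G -> bool -> 'I_3) (g0 : G) (M : nat).
Hypothesis gen : generates pi.
Hypothesis tau_mult : forall x (l : seq (seq bool)), uniq l ->
  (forall w, w \in l -> H (tree_node q s g0 w ** ginv x)) -> (size l <= M)%N.

(** The flow inequality is applied to [v] along the tree. Finite support and bounded multiplicity
    make the mean of [v] on a deep level small, while [v] at the root is tied to [v 1g = 1] by a
    path to [g0]. *)
Lemma tree_energy_lower_bound : exists2 k : R, 0 < k &
  forall v O, coset_invariant v -> (forall x, 0 <= v x) ->
  (forall x, v x != 0 -> exists2 y, y \in O & coset x y) ->
  (forall x a, v (step x a) != 0 -> exists2 y, y \in O & coset x y) ->
  v 1g = 1 -> 1 <= k * energy v O.
Proof.
have /boolp.choice [u Hu] : forall i, exists w, eval_word pi w = q i by move=> i; apply: gen.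
have [u0 Hu0] := gen g0.
pose k : R := path_cost u0 + 2 * \sum_i path_cost (u i) * M%:R.
have k0 : 0 <= k.
  rewrite addr_ge0 ?path_cost_ge0 // mulr_ge0 // sumr_ge0 // => i _.
  by rewrite mulr_ge0 ?path_cost_ge0.
(* The errors are [1 / 4] from the root, [1 / 8] from level [n] and [1 / 4] from the flow, leaving
   [3 / 8 <= k * E]; adding 1 makes the constant positive. *)
exists (8 / 3 * k + 1); first by lra.
move=> v O vH v0 vO vO' v1; have E0 := energy_ge0 v O.
set E := energy v O in E0 *.
have mul l : uniq l -> multiplicity_le (tree_node q s g0) l M.
  move=> ul x; rewrite -size_filter; apply: (tau_mult (x := x)); first exact: filter_uniq.
  by move=> w; rewrite mem_filter => /andP [/asboolP].
pose f w := v (tree_node q s g0 w).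
have root : 1 - f [::] <= path_cost u0 * E + 1 / 4.
  have mul1 : multiplicity_le (fun _ : unit => 1g) [:: tt] 1.
    by move=> x /=; case: `[< _ >].
  have := @sum_path_energy v O vH vO vO' u0 _ _ _ _ mul1.
  rewrite big_seq1 gmul1l Hu0 v1 -/E /f /= => H1.
  have := sqr_ge0 (1 - v g0 - 1 / 2); move: H1; rewrite !expr2; lra.
have tree n : \sum_(w <- tree_ball n) \sum_(b : bool) (f w - f (b :: w)) ^+ 2 <=
    2 * \sum_i path_cost (u i) * M%:R * E.
  apply: (@le_trans _ _ (\sum_(w <- tree_ball n)
     2 * \sum_i (v (tree_node q s g0 w) - v (tree_node q s g0 w ** q i)) ^+ 2)).
    apply: ler_sum => w _; rewrite mulr_natl mulr2n big_bool.
    have term b : (f w - f (b :: w)) ^+ 2 <=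
        \sum_i (v (tree_node q s g0 w) - v (tree_node q s g0 w ** q i)) ^+ 2.
      rewrite (bigD1 (s (tree_node q s g0 w) b)) //= lerDl.
      by apply: sumr_ge0 => i _; apply: sqr_ge0.
    exact: lerD.
  rewrite -mulr_sumr ler_wpM2l // exchange_big /=; apply: ler_sum => i _.
  by rewrite -mulrA -Hu; apply: sum_path_energy => //; apply/mul/tree_ball_uniq.
pose Sv := M%:R * \sum_(x <- O) v x.
have Sv0 : 0 <= Sv by rewrite mulr_ge0 ?sumr_ge0.
(* This depth depends on [v] and [O], but the constant [k] does not. *)
pose n := Num.bound (8 * Sv).
have small : (\sum_(w <- tree_level n) f w) / 2 ^+ n <= 1 / 8.
  rewrite ler_pdivrMr ?exprn_gt0 //.
  apply: (@le_trans _ _ Sv).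
    by apply: sum_multiplicity_le => //; apply/mul/tree_level_uniq.
  have := archi_boundP (mulr_ge0 (ler0n R 8) Sv0); rewrite -/n => bn.
  have : (n%:R : R) <= 2 ^+ n by rewrite -natrX ler_nat ltnW // ltn_expl.
  by lra.
have flow := tree_flow f n.
have t0 : (0 : R) < 2 ^- n by rewrite invr_gt0 exprn_gt0.
have kE : k * E = path_cost u0 * E + 2 * \sum_i path_cost (u i) * M%:R * E.
  by rewrite /k mulrDl -mulrA mulr_suml.
have := tree n; lra.
Qed.

End Energy.

(** * Hitting probabilities *)

Lemma sum_tupleS (S : finType) n (F : seq S -> nat) :
  (\sum_(t : n.+1.-tuple S) F t = \sum_(a : S) \sum_(t : n.-tuple S) F (a :: t))%N.
Proof.
rewrite pair_big (reindex (fun p : S * n.-tuple S => [tuple of p.1 :: p.2])) //=.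
exists (fun t => (thead t, [tuple of behead t])) => [[a t] _|t _] /=.
  by congr pair; apply: val_inj.
by rewrite [RHS]tuple_eta; apply: val_inj.
Qed.

Lemma bernoulli (R : realFieldType) (e : R) n : 0 <= e <= 1 -> (1 - e) ^+ n * (1 + n%:R * e) <= 1.
Proof.
move=> /andP [e0 e1]; elim: n => [|n IH]; first by rewrite expr0; lra.
apply: le_trans IH; rewrite exprSr -mulrA ler_wpM2l ?exprn_ge0 //; first by lra.
by rewrite -natr1; have := ler0n R n; nra.
Qed.

Section Walk.
Variables (R : archiRealFieldType) (G : AbsGroup) (A : finType) (pi : A -> G).
Variable H : G -> Prop.
Hypothesis sgH : subgroup H.
Hypothesis A_gt0 : (0 < #|A|)%N.
Local Notation "1g" := (gone G).
Local Notation step x a := (x ** letter pi a).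
Local Notation ev := (eval_word pi).
Local Notation S := (A * bool)%type.
Local Notation deg := (#|{: S}|%:R : R).

Fixpoint first_hit (x : G) (t : seq S) : bool :=
  if t is a :: t' then ~~ `[< H x >] && first_hit (step x a) t' else `[< H x >].

Lemma first_hitP x t : first_hit x t <->
  H (x ** ev t) /\ forall k, (k < size t)%N -> ~ H (x ** ev (take k t)).
Proof.
elim: t x => [|a t IH] x /=.
  by rewrite gmul1r; split=> [/asboolP|[/asboolP]].
split=> [/andP [/asboolP nHx /IH [Ht Hk]]|[Ht Hk]].
  split=> [|[|k] lt_k] /=; rewrite ?gmul1r // gmulA //; exact: Hk.
apply/andP; split.
  by apply/asboolP => Hx; apply: (Hk 0%N) => //=; rewrite gmul1r.
apply/IH; rewrite gmulAr; split=> // k lt_k.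
by have := Hk k.+1 lt_k; rewrite /= gmulA.
Qed.

Lemma first_hit_invariant h x t : H h -> first_hit (h ** x) t = first_hit x t.
Proof.
move=> Hh; have [_ [HM HV]] := sgH.
have E y : `[< H (h ** y) >] = `[< H y >].
  apply/asbool_equiv_eq; split=> [Hy|]; last exact: HM.
  by rewrite -(gmulKl h y); apply: HM => //; apply: HV.
by elim: t x => [|a t IH] x /=; rewrite E // gmulAr IH.
Qed.

Definition hit_count n x : nat := (\sum_(t : n.-tuple S) first_hit x t)%N.

Lemma hit_count0 x : hit_count 0 x = `[< H x >].
Proof.
rewrite /hit_count (bigD1 [tuple]) //= big1 ?addn0 // => t /eqP.
by rewrite tuple0.
Qed.

Lemma hit_countS n x :
  hit_count n.+1 x = if `[< H x >] then 0%N else (\sum_(a : S) hit_count n (step x a))%N.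
Proof.
rewrite /hit_count (sum_tupleS n (fun t => first_hit x t)) /=.
by case: `[< H x >] => //=; rewrite big1 // => a _; rewrite big1.
Qed.

(** A first return at time [n.+1] is a first letter followed by a first hit of [H] after [n] more
    steps. *)
Lemma first_return_card n :
  #|[set t : n.+1.-tuple S | first_return_b pi H t]| =
  (\sum_(a : S) hit_count n (letter pi a))%N.
Proof.
rewrite -sum1_card -(sum_tupleS n (fun t => if t is a :: t' then first_hit (letter pi a) t' else 0%N)).
rewrite big_mkcond; apply: eq_bigr => t _; case/tupleP: t => a t; rewrite inE /=.
suff -> : first_return_b pi H [tuple of a :: t] = first_hit (letter pi a) t by case: first_hit.
rewrite /first_return_b; case: excluded_middle_informative => /= [|nH].
  move=> [_ [Hn Hk]]; apply/esym/first_hitP; split.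
    move: Hn; rewrite /same_rcoset /walk_pos ginv1 gmul1r take_oversize //=.
    by rewrite size_tuple.
  move=> k; rewrite size_tuple => lt_k; have := Hk k.+1 isT lt_k.
  by rewrite /same_rcoset /walk_pos ginv1 gmul1r.
apply/esym/negP => /first_hitP [Hn Hk]; apply: nH; split=> //.
rewrite /same_rcoset /walk_pos ginv1 gmul1r take_oversize /= ?size_tuple //; split=> //.
move=> [|k] // _ lt_k; rewrite gmul1r /=; apply: Hk; by rewrite size_tuple.
Qed.

Definition hit_prob N x : R := \sum_(n < N.+1) (hit_count n x)%:R / deg ^+ n.

Lemma deg_gt0 : 0 < deg.
Proof. by rewrite ltr0n card_prod card_bool muln_gt0 A_gt0. Qed.

Lemma sum_hit_prob N (y : S -> G) :
  \sum_(n < N.+1) (\sum_(a : S) hit_count n (y a))%N%:R / deg ^+ n.+1 =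
  (\sum_(a : S) hit_prob N (y a)) / deg.
Proof.
rewrite exchange_big mulr_suml; apply: eq_bigr => n _ /=.
by rewrite natr_sum -!mulr_suml exprSr invfM mulrA.
Qed.

Lemma hit_prob_ge0 N x : 0 <= hit_prob N x.
Proof. by apply: sumr_ge0 => n _; rewrite divr_ge0 // exprn_ge0. Qed.

Lemma hit_prob_leS N x : hit_prob N x <= hit_prob N.+1 x.
Proof. by rewrite /hit_prob [leRHS]big_ord_recr lerDl divr_ge0 // exprn_ge0. Qed.

Lemma hit_prob_le N N' x : (N <= N')%N -> hit_prob N x <= hit_prob N' x.
Proof.
move=> /subnK <-; elim: (N' - N)%N => // m IH.
by rewrite addSn; apply: le_trans IH (hit_prob_leS _ _).
Qed.

Lemma hit_prob_H N x : H x -> hit_prob N x = 1.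
Proof.
move=> Hx; rewrite /hit_prob big_ord_recl hit_count0 (asboolT Hx) expr0 divr1.
by rewrite big1 ?addr0 // => n _; rewrite hit_countS (asboolT Hx) mul0r.
Qed.

Lemma hit_prob0 x : ~ H x -> hit_prob 0 x = 0.
Proof. by move=> Hx; rewrite /hit_prob big_ord1 hit_count0 (asboolF Hx) mul0r. Qed.

Lemma hit_probS N x : ~ H x ->
  hit_prob N.+1 x = (\sum_(a : S) hit_prob N (step x a)) / deg.
Proof.
move=> Hx; rewrite -sum_hit_prob /hit_prob big_ord_recl hit_count0 (asboolF Hx) mul0r add0r.
by apply: eq_bigr => n _; rewrite hit_countS (asboolF Hx).
Qed.

Lemma hit_prob_invariant N : coset_invariant H (hit_prob N).
Proof.
move=> h x Hh; apply: eq_bigr => n _; congr (_%:R / _).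
by apply: eq_bigr => t _; rewrite first_hit_invariant.
Qed.

Lemma hit_prob_le1 N x : hit_prob N x <= 1.
Proof.
elim: N x => [|N IH] x; case: (pselect (H x)) => [Hx|nHx];
  try by rewrite hit_prob_H.
  by rewrite hit_prob0.
rewrite hit_probS // ler_pdivrMr ?deg_gt0 // mul1r.
apply: (@le_trans _ _ (\sum_(a : S) 1)); first by apply: ler_sum.
by rewrite sumr_const.
Qed.

Lemma hit_prob_supp N x : hit_prob N x != 0 ->
  exists2 w, (size w <= N)%N & H (x ** ev w).
Proof.
elim: N x => [|N IH] x; case: (pselect (H x)) => [Hx|nHx];
  try by exists [::]; rewrite //= gmul1r.
  by rewrite hit_prob0 // eqxx.
rewrite hit_probS // => nz.
have [a /IH [w sw Hw]] : exists a, hit_prob N (step x a) != 0.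
  apply: contrapT => none; case/negP: nz; rewrite big1 ?mul0r // => a _.
  by apply: contrapT => /eqP nz; apply: none; exists a.
by exists (a :: w); rewrite //= gmulA.
Qed.

Lemma escape_sum N x :
  \sum_(a : S) (1 - hit_prob N (step x a)) = deg - \sum_(a : S) hit_prob N (step x a).
Proof. by rewrite sumrB sumr_const. Qed.

(** * Infinite index: a uniform escape probability *)

Section Transient.
Variables (q : 'I_3 -> G) (s : G -> bool -> 'I_3) (g0 : G) (M : nat).
Hypothesis gen : generates pi.
Hypothesis tau_mult : forall x (l : seq (seq bool)), uniq l ->
  (forall w, w \in l -> H (tree_node q s g0 w ** ginv x)) -> (size l <= M)%N.

(** Off [H], [hit_prob N] is at most [hit_prob N.+1], its average over neighbors. This
    subharmonicity bounds its energy by the escape rate, and the tree bounds the energy below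
    independently of [N]. *)
Lemma escape_lower_bound : exists2 c : R, 0 < c &
  forall N, (\sum_(a : S) hit_prob N (letter pi a)) / deg <= 1 - c.
Proof.
have [k k0 Hk] := tree_energy_lower_bound R gen tau_mult.
have d0 := deg_gt0.
exists ((2 * k * deg)^-1); first by rewrite invr_gt0 !mulr_gt0.
(* Radius [N.+1] also covers the neighbors of the support. *)
move=> N; have [l Hl] := ball_finite gen N.+1.
have [O [uO iO cO]] := inequivalent_cover sgH l.
have supp x w : (size w <= N.+1)%N -> H (x ** ev w) ->
    exists2 y, y \in O & same_rcoset H x y.
  move=> sw Hw; have [|y yO cy] := cO (ginv (ev w)).
    apply: Hl; rewrite -eval_inv_word -[eval_word _ _]gmul1l.
    apply: leq_trans (wdist_le_size gen _ _) _; by rewrite size_rev size_map.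
  exists y => //; have [_ [HM _]] := sgH; have := HM _ _ Hw cy.
  by rewrite /same_rcoset !gE.
have vO x : hit_prob N x != 0 -> exists2 y, y \in O & same_rcoset H x y.
  by move=> /hit_prob_supp [w sw]; apply: supp; apply: leqW.
have vO' x a : hit_prob N (step x a) != 0 -> exists2 y, y \in O & same_rcoset H x y.
  by move=> /hit_prob_supp [w sw]; rewrite gmulAr; apply: (@supp x (a :: w)).
have v0 := hit_prob_ge0 N; have vH := @hit_prob_invariant N.
have v1 x : H x -> hit_prob N x = 1 by apply: hit_prob_H.
have := Hk _ O vH v0 vO vO' (v1 _ sgH.1).
have : energy pi (hit_prob N) O <= 2 * \sum_(a : S) (1 - hit_prob N (letter pi a)).
  apply: (energy_le_escape sgH vH v0 vO uO iO v1) => x nHx.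
  rewrite sumrB sumr_const -mulr_natr subr_le0.
  rewrite -ler_pdivlMr // -hit_probS //; exact: hit_prob_leS.
rewrite sumrB sumr_const; set e := energy _ _ _; set s' := \sum_a _ => le_e ge_e.
rewrite -subr_ge0.
have -> : 1 - (2 * k * deg)^-1 - s' / deg = (k * (2 * (deg - s')) - 1) / (2 * k * deg).
  by field; rewrite !gt_eqF.
have le_ke : k * e <= k * (2 * (deg - s')) by rewrite ler_wpM2l // ltW.
by apply: divr_ge0; [rewrite subr_ge0 (le_trans ge_e)|rewrite !mulr_ge0 // ltW].
Qed.

End Transient.

(** * Finite index: geometric decay of the escape probability *)

Section Recurrent.

(** The walk follows [u] with probability at least [deg ^- size u] and then hits [H]; if it
    deviates, at least [N] steps remain, so it escapes with probability at most [W]. *)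
Lemma escape_contract N (W : R) : 0 <= W -> (forall x, 1 - hit_prob N x <= W) ->
  forall u x j, H (x ** ev u) -> (size u <= j)%N ->
  1 - hit_prob (j + N) x <= (1 - deg ^- size u) * W.
Proof.
move=> W0 HW; have d1 : 1 <= deg.
  by rewrite ler1n card_prod card_bool muln_gt0 A_gt0.
have d0 := deg_gt0.
elim=> [|a u IH] x j Hu; case: (pselect (H x)) => [Hx|nHx] le_j;
  try by rewrite hit_prob_H // subrr mulr_ge0 // subr_ge0 invf_le1 ?exprn_gt0 ?exprn_ege1.
  by case: nHx; move: Hu; rewrite /= gmul1r.
case: j le_j => // j le_j; rewrite addSn hit_probS // -[X in X - _](mulfV (lt0r_neq0 d0)).
rewrite -mulrBl -escape_sum ler_pdivrMr // (bigD1 a) //=.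
have IHa : 1 - hit_prob (j + N) (step x a) <= (1 - deg ^- size u) * W.
  by apply: IH => //; rewrite gmulAr.
have others : \sum_(b | b != a) (1 - hit_prob (j + N) (step x b)) <= (deg - 1) * W.
  apply: (@le_trans _ _ (\sum_(b : S | b != a) W)).
    apply: ler_sum => b _; apply: le_trans (HW (step x b)).
    by rewrite lerD2l lerN2 hit_prob_le // leq_addl.
  by rewrite sumr_const cardC1 -[W *+ _]mulr_natl -subn1 natrB // -(ltr0n R).
apply: le_trans (lerD IHa others) _.
rewrite exprS invfM; set t := deg ^- size u.
have -> : (1 - deg^-1 * t) * W * deg = (deg - t) * W by field; rewrite gt_eqF.
lra.
Qed.

Hypothesis gen : generates pi.
Hypothesis fiH : finite_index H.

Lemma uniform_return : exists m, forall x, exists2 w, (size w <= m)%N & H (x ** ev w).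
Proof.
have [l Hl] := fiH.
have [m Hm] : exists m, forall y, List.In y l -> exists2 w, (size w <= m)%N & ev w = ginv y.
  elim: l {Hl} => [|y l [m Hm]]; first by exists 0%N.
  have [w Hw] := gen (ginv y); exists (maxn (size w) m) => z [<-|/Hm [w' sw' Hw']].
    by exists w => //; rewrite leq_maxl.
  by exists w' => //; rewrite leq_max sw' orbT.
exists m => x; have [y [yl xy]] := Hl x; have [w sw Hw] := Hm y yl.
by exists w; rewrite // Hw.
Qed.

Lemma escape_vanishes (e : R) : 0 < e ->
  exists N0, forall N x, (N0 <= N)%N -> 1 - hit_prob N x < e.
Proof.
move=> e0; have [m Hm] := uniform_return; have d0 := deg_gt0.
have d1 : 1 <= deg by rewrite ler1n card_prod card_bool muln_gt0 A_gt0.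
pose t : R := deg ^- m; have t0 : 0 < t by rewrite invr_gt0 exprn_gt0.
have t1 : t <= 1 by rewrite invf_le1 ?exprn_gt0 // exprn_ege1.
have geom k x : 1 - hit_prob (k * m) x <= (1 - t) ^+ k.
  elim: k x => [|k IH] x; first by rewrite expr0; have := hit_prob_ge0 (0 * m) x; lra.
  have [w sw Hw] := Hm x; rewrite mulSn.
  have W0 : 0 <= (1 - t) ^+ k by rewrite exprn_ge0 // subr_ge0.
  apply: le_trans (escape_contract W0 IH Hw sw) _; rewrite exprS ler_wpM2r // lerD2l lerN2.
  by rewrite lef_pV2 ?posrE ?exprn_gt0 // ler_weXn2l.
(* Then [1 + k%:R * t] exceeds [e^-1], and [bernoulli] gives [(1 - t) ^+ k < e]. *)
pose k := Num.bound ((e * t)^-1).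
exists (k * m)%N => N x le_N.
apply: le_lt_trans (_ : 1 - hit_prob (k * m) x < e).
  by rewrite lerD2l lerN2 hit_prob_le.
apply: le_lt_trans (geom k x) _.
have kb : (e * t)^-1 < k%:R by apply: archi_boundP; rewrite invr_ge0 mulr_ge0 // ltW.
have kt : e^-1 < 1 + k%:R * t.
  by move: kb; rewrite invfM ltr_pdivrMr //; lra.
have kt0 : 0 < 1 + k%:R * t by apply: lt_trans kt; rewrite invr_gt0.
have := @bernoulli _ t k; rewrite (ltW t0) t1 => /(_ isT).
rewrite -ler_pdivlMr // mul1r => /le_lt_trans; apply.
by rewrite -[e]invrK ltf_pV2 ?posrE ?invr_gt0.
Qed.

Lemma return_sum_cvg (e : R) : 0 < e -> exists N0, forall N, (N0 <= N)%N ->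
  `|(\sum_(a : S) hit_prob N (letter pi a)) / deg - 1| < e.
Proof.
move=> e0; have d0 := deg_gt0; have e2 : 0 < e / 2 by rewrite divr_gt0.
have [N0 HN0] := escape_vanishes e2; exists N0 => N le_N.
have le1 : \sum_(a : S) hit_prob N (letter pi a) <= deg.
  by rewrite -sumr_const; apply: ler_sum => a _; apply: hit_prob_le1.
have : \sum_(a : S) (1 - hit_prob N (letter pi a)) <= \sum_(a : S) (e / 2).
  by apply: ler_sum => a _; apply/ltW/HN0.
rewrite sumrB !sumr_const -[(e / 2) *+ _]mulr_natl => ge1.
rewrite distrC ger0_norm ?subr_ge0 ?ler_pdivrMr ?mul1r // ltrBlDl -ltrBlDr ltr_pdivlMr //.
by have := mulr_gt0 d0 e2; lra.
Qed.

End Recurrent.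
End Walk.

(** * Return probabilities and the dichotomy *)

Lemma return_prob_sum (G : AbsGroup) (A : finType) (pi : A -> G) (H : G -> Prop) N :
  sum_f_R0 (fun n => first_return_prob pi H n.+1) N =
  (\sum_(a : A * bool) hit_prob Rdefinitions.R pi H N (letter pi a)) / #|{: A * bool}|%:R.
Proof.
rewrite sum_f_R0E big_mkord -sum_hit_prob; apply: eq_bigr => n _.
by rewrite /first_return_prob RdivE !INRE first_return_card natrX card_prod card_bool mulnC.
Qed.

(** Over an empty alphabet only the empty word exists, so [G] would be trivial. *)
Lemma generates_card_gt0 (G : AbsGroup) (A : finType) (pi : A -> G) :
  non_elementary G -> generates pi -> (0 < #|A|)%N.
Proof.
move=> ne gen; rewrite lt0n; apply/eqP => A0; apply: ne.
exists (gone G), [:: gone G] => g; exists (gone G); split; first by left.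
have [[|[a b] w] <-] := gen g; last by have := max_card (pred1 a); rewrite A0 card1.
by rewrite /same_rcoset ginv1 gmul1r; exists Z0.
Qed.

Theorem theorem1p3 (G : AbsGroup) (A : finType) (pi : A -> G) (H : G -> Prop) :
  torsion_free G -> non_elementary G -> word_hyperbolic G ->
  generates pi ->
  subgroup H -> quasiconvex pi H ->
  (srw_transient pi H <-> ~ finite_index H).
Proof.
move=> tf ne hyp gen sgH qcH; have A0 := generates_card_gt0 ne gen.
split=> [trans fiH|infH recur].
  apply: trans => e /RltP e0.
  have [N0 HN0] := return_sum_cvg A0 gen fiH e0.
  exists N0 => N /ssrnat.leP le_N; apply/RltP.
  by rewrite RdistE return_prob_sum; apply: HN0.
have [q [s [g0 [M HM]]]] := coset_tree tf ne hyp gen sgH qcH infH.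
have [c c0 Hc] := escape_lower_bound Rdefinitions.R sgH A0 gen HM.
(* Convergence to 1 with precision [c] would push a partial sum above [1 - c]. *)
move/RltP: (c0) => /recur [N /(_ N (Nat.le_refl N)) /RltP].
rewrite RdistE R1E return_prob_sum distrC => /ltr_normlW.
by rewrite ltrBlDl -ltrBlDr ltNge Hc.
Qed.
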